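(* Let $\mathbb{X}$ be a finite dimensional real inner product space, $\mathcal{K}\subseteq\mathbb{X}$ a nonempty closed convex cone, $b\in\mathbb{X}$, and $T\colon\mathbb{X}\to\mathbb{X}$ an invertible linear operator. Assume that $\|T^{-1}\|<1$. Then the equation $P_{\mathcal{K}}(x)+Tx=b$ has a unique solution $\overline{x}\in\mathbb{X}$, and for any initial point $x^0\in\mathbb{X}$ the semi-smooth Newton sequence $\{x^k\}$ generated by $$(V(x^k)+T)x^{k+1}=b,\qquad V(x^k)\in\partial_C P_{\mathcal{K}}(x^k),\qquad k\in\mathbb{N},$$ is well-defined. Additionally, if $\|T^{-1}\|<\frac12$, then the sequence $\{x^k\}$ converges $Q$-linearly to $\overline{x}$ and satisfies $$\|x^{k+1}-\overline{x}\|\le\frac{\|T^{-1}\|}{1-\|T^{-1}\|}\,\|x^k-\overline{x}\|,\qquad k\in\mathbb{N}.$$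
   Context: $\|x\|=\sqrt{\langle x,x\rangle}$, and for a linear operator $T$, $\|T\|=\max\{\|Tx\| : \|x\|=1\}$. $P_{\mathcal{K}}(x)=\operatorname{argmin}\{\|y-x\| : y\in\mathcal{K}\}$ is the projection onto $\mathcal{K}$. For $F\colon\mathbb{X}\to\mathbb{X}$, with $D_F$ the set of points where $F$ is differentiable and $F'$ its Jacobian, $\partial_C F(x)=\operatorname{conv}\{\lim_{k\to\infty}F'(x_k) : x_k\to x,\ x_k\in D_F\}$ is the set of Clarke generalized Jacobians. In the iteration, $V(x^k)$ is an arbitrary chosen element of $\partial_C P_{\mathcal{K}}(x^k)$; ''well-defined'' means that at each step the linear system for $x^{k+1}$ is uniquely solvable, i.e. $V(x^k)+T$ is invertible. $\mathbb{N}$ denotes the nonnegative integers. $Q$-linear convergence to $\overline{x}$ means $x^k\to\overline{x}$ and $\|x^{k+1}-\overline{x}\|\le r\|x^k-\overline{x}\|$ for some constant $r\in[0,1)$ and all $k$. *)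

(* Defs.v *)
From HB Require Import structures.
From mathcomp Require Import all_boot all_order all_algebra.
From mathcomp Require Import sesquilinear.
From mathcomp Require Import all_classical all_reals all_analysis.

Set Implicit Arguments.
Unset Strict Implicit.
Unset Printing Implicit Defensive.

Import Order.TTheory GRing.Theory Num.Theory.
Import numFieldNormedType.Exports.

Local Open Scope classical_set_scope.
Local Open Scope ring_scope.

(* Finite-dimensional normed spaces: [vectType] provides finite dimension and
   the linear maps ['End(X)]; [normedModType] provides the norm, the topology
   and differentiability. *)
#[short(type="normedVectType")]
HB.structure Definition NormedVector (R : numFieldType) :=
  {X of NormedModule R X & Vector R X}.

(* The maximum in the usual definition is written as a supremum.  If the space
   is zero, the set is empty and the value is [sup set0 = 0]. *)
Definition opnorm (R : realType) (X : normedVectType R) (T : 'End(X)) : R :=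
  sup [set `|T x| | x in [set x : X | `|x| = 1]].

Definition argmin (R : realType) (X : Type) (A : set X) (f : X -> R) : set X :=
  [set p | A p /\ forall y, A y -> f p <= f y].

(* [get] picks an element of the argmin; on a nonempty closed convex set the
   argmin is a singleton. *)
Definition metric_proj (R : realType) (X : normedVectType R) (K : set X) (x : X) : X :=
  get (argmin K (fun y => `|y - x|)).

Definition cone (R : realType) (X : lmodType R) (K : set X) : Prop :=
  forall (t : R) (x : X), 0 < t -> K x -> K (t *: x).

Definition conv_hull (R : realType) (E : lmodType R) (S : set E) : set E :=
  [set v | exists (n : nat) (t : 'I_n -> R) (s : 'I_n -> E),
    [/\ forall i, 0 <= t i, \sum_(i < n) t i = 1, forall i, S (s i)
      & v = \sum_(i < n) t i *: s i]].

(* Limits of Jacobians along sequences of differentiability points tending to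
   [x]; convergence in ['End(X)] is convergence in operator norm. *)
Definition limiting_jacobians (R : realType) (X : normedVectType R)
    (F : X -> X) (x : X) : set 'End(X) :=
  [set L | exists x_ : nat -> X,
    [/\ forall k, differentiable F (x_ k), x_ @ \oo --> x
      & opnorm (linfun ('d F (x_ k)) - L) @[k --> \oo] --> (0 : R)]].

Definition clarke_jacobian (R : realType) (X : normedVectType R)
    (F : X -> X) (x : X) : set 'End(X) :=
  conv_hull (limiting_jacobians F x).

(* The first [n] steps of the iteration, with [V n] already chosen:
   [x 0, ..., x n] and [V 0, ..., V n] are constrained, later terms are not. *)
Definition newton_run (R : realType) (X : normedVectType R) (F : X -> X)
    (T : 'End(X)) (b x0 : X) (n : nat) (x : nat -> X) (V : nat -> 'End(X)) :
    Prop :=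
  [/\ x 0%N = x0,
      forall k, (k <= n)%N -> clarke_jacobian F (x k) (V k)
    & forall k, (k < n)%N -> (V k + T) (x k.+1) = b].

Definition newton_sequence (R : realType) (X : normedVectType R) (F : X -> X)
    (T : 'End(X)) (b x0 : X) (x : nat -> X) (V : nat -> 'End(X)) : Prop :=
  [/\ x 0%N = x0,
      forall k, clarke_jacobian F (x k) (V k)
    & forall k, (V k + T) (x k.+1) = b].

(* However the elements of the Clarke Jacobian were chosen so far, the next
   linear system is uniquely solvable; hence every rule [V] for choosing these
   elements generates exactly one infinite sequence. *)
Definition newton_well_defined (R : realType) (X : normedVectType R)
    (F : X -> X) (T : 'End(X)) (b x0 : X) : Prop :=
  (forall n x V, newton_run F T b x0 n x V -> bijective (V n + T)) /\
  (forall V : nat -> X -> 'End(X),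
     (forall k y, clarke_jacobian F y (V k y)) ->
     exists! x : nat -> X, newton_sequence F T b x0 x (fun k => V k (x k))).

Definition Qlinear_cvg (R : realType) (X : normedVectType R)
    (x : nat -> X) (xbar : X) : Prop :=
  x @ \oo --> xbar /\
  exists2 r : R, 0 <= r < 1 &
    forall k, `|x k.+1 - xbar| <= r * `|x k - xbar|.

(* Main.v *)
(* The sharp constant comes from the reflection [2 P - id] of the projection
   [P], which is nonexpansive.  This passes to derivatives, to their limits and
   to convex combinations, so every Clarke Jacobian [V] of [P] satisfies
   [|2 V v - v| <= |v|]; in particular [|V v| <= |v|], and [V + T] is injective
   because [|T^-1| < 1].  As [P] is positively homogeneous, Euler's identity
   gives [V x = P x] for [V] in the Clarke Jacobian at [x].  Hence the Newton
   step [x'] satisfies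
     [T (x' - xbar) = (P xbar - P x - V (xbar - x)) - V (x' - xbar)],
   where the first bracket is half the difference of
   [(2 P - id) xbar - (2 P - id) x] and [(2 V - id) (xbar - x)], both of norm at
   most [|x - xbar|].  Existence of [xbar] is Banach's theorem for
   [x |-> T^-1 (b - P x)]. *)

Require Import Defs.
From HB Require Import structures.
From mathcomp Require Import all_boot all_order all_algebra.
From mathcomp Require Import sesquilinear.
From mathcomp Require Import all_classical all_reals all_analysis.
From mathcomp Require Import ring lra.

Set Implicit Arguments.
Unset Strict Implicit.
Unset Printing Implicit Defensive.

Import Order.TTheory GRing.Theory Num.Theory.
Import numFieldNormedType.Exports.

Local Open Scope classical_set_scope.
Local Open Scope ring_scope.

(** * Inner product calculus, Cauchy-Schwarz and Riesz representation *)

Section InnerProduct.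
Context (R : realType) (X : normedVectType R) (ip : {dot X for idfun}).
Hypothesis norm_ip : forall x : X, `|x| = Num.sqrt (ip x x).

Lemma ipC (x y : X) : ip x y = ip y x.
Proof. by rewrite (hermC ip x y) expr0 mul1r. Qed.

Lemma ipDl (x y z : X) : ip (x + y) z = ip x z + ip y z.
Proof. exact: linearDl. Qed.

Lemma ipZl (a : R) (x z : X) : ip (a *: x) z = a * ip x z.
Proof. exact: linearZl_LR. Qed.

Lemma ipNl (x z : X) : ip (- x) z = - ip x z.
Proof. exact: linearNl. Qed.

Lemma ipDr (x y z : X) : ip z (x + y) = ip z x + ip z y.
Proof. by rewrite !(ipC z) ipDl. Qed.

Lemma ipZr (a : R) (x z : X) : ip z (a *: x) = a * ip z x.
Proof. by rewrite !(ipC z) ipZl. Qed.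

Lemma ipNr (x z : X) : ip z (- x) = - ip z x.
Proof. by rewrite !(ipC z) ipNl. Qed.

Lemma ip0l (z : X) : ip 0 z = 0.
Proof. by rewrite -(scale0r z) ipZl mul0r. Qed.

Lemma ip0r (z : X) : ip z 0 = 0.
Proof. by rewrite ipC ip0l. Qed.

Lemma ip_sumr (n : nat) (u : X) (G : 'I_n -> X) :
  ip u (\sum_j G j) = \sum_j ip u (G j).
Proof. by elim/big_rec2 : _ => [|j a c _ <-]; rewrite ?ipDr ?ip0r. Qed.

Let ipE := (ipDl, ipDr, ipZl, ipZr, ipNl, ipNr).

Lemma ip_norm (x : X) : ip x x = `|x| ^+ 2.
Proof.
rewrite norm_ip sqr_sqrtr//.
have [->|x0] := eqVneq x 0; last exact/ltW/neq0_dnorm_gt0.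
by rewrite ip0l.
Qed.

Lemma ip_eq0 (x : X) : ip x x = 0 -> x = 0.
Proof. by move/eqP; rewrite ip_norm sqrf_eq0 normr_eq0 => /eqP. Qed.

Lemma ip_le_normM (x y : X) : ip x y <= `|x| * `|y|.
Proof.
have [->|x0] := eqVneq x 0; first by rewrite ip0l normr0 mul0r.
have [->|y0] := eqVneq y 0; first by rewrite ip0r normr0 mulr0.
have nx : 0 < `|x| by rewrite normr_gt0.
have ny : 0 < `|y| by rewrite normr_gt0.
(* Expanding this square gives [2 |x| |y| (|x| |y| - <x, y>)], and the factor [|x| |y|] is
   positive. *)
have := sqr_ge0 `| `|y| *: x - `|x| *: y |.
rewrite -ip_norm !ipE (ipC y x) !ip_norm => h.
rewrite -subr_ge0 -(@pmulr_rge0 _ (`|x| * `|y|)) ?mulr_gt0//.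
nra.
Qed.

Lemma norm_ip_le (x y : X) : `|ip x y| <= `|x| * `|y|.
Proof.
rewrite ler_norml ip_le_normM andbT -lerN2 opprK -ipNl.
by rewrite (le_trans (ip_le_normM _ _))// normrN.
Qed.

(* Riesz representation by dimension count: [r |-> sum_i <r, e_i> e_i] is
   injective, hence onto, and a preimage of [e_i] represents the [i]-th
   coordinate. *)
Lemma coord_riesz (i : 'I_(\dim {:X})) :
  exists r : X, forall x, coord (vbasis {:X}) i x = ip r x.
Proof.
set e := vbasis {:X}.
have be : basis_of {:X} e := vbasisP _.
have xE x : x = \sum_(j < \dim {:X}) coord e j x *: e`_j.
  exact/coord_vbasis/memvf.
pose F (r : X) : X := \sum_(j < \dim {:X}) ip r e`_j *: e`_j.
have linF : linear F.
  move=> a x y; rewrite /F scaler_sumr -big_split/=; apply: eq_bigr => j _.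
  by rewrite ipDl ipZl scalerDl scalerA.
pose Flin := GRing.isLinear.Build R X X *:%R F linF.
pose FL : {linear X -> X} := HB.pack F Flin.
have coordF r (j : 'I_(\dim {:X})) : coord e j (F r) = ip r e`_j.
  by rewrite coord_sum_free// (basis_free be).
have kerF : lker (linfun FL) == 0%VS.
  apply/lker0P => x y; rewrite !lfunE/= => Fxy.
  apply/eqP; rewrite -subr_eq0; apply/eqP/ip_eq0.
  rewrite {2}(xE (x - y)).
  rewrite ip_sumr big1// => j _; rewrite ipZr ipDl ipNl -!coordF Fxy subrr.
  by rewrite mulr0.
have : e`_i \in limg (linfun FL) by rewrite lker0_limgf// memvf.
move=> /memv_imgP[r _]; rewrite lfunE/= => Fr.
exists r => x; rewrite {2}(xE x).
rewrite ip_sumr (bigD1 i)//= big1 => [|j ji].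
  by rewrite addr0 ipZr -coordF -Fr coord_free ?eqxx ?mulr1// (basis_free be).
rewrite ipZr -coordF -Fr coord_free ?(basis_free be)//.
by rewrite eq_sym (negbTE ji) mulr0.
Qed.

End InnerProduct.

(** * Completeness and bounded operators in finite dimension *)

Section FiniteDimension.
Context (R : realType) (X : normedVectType R) (ip : {dot X for idfun}).
Hypothesis norm_ip : forall x : X, `|x| = Num.sqrt (ip x x).

Let coordE (x : X) :
  x = \sum_(j < \dim {:X}) coord (vbasis {:X}) j x *: (vbasis {:X})`_j.
Proof. exact/coord_vbasis/memvf. Qed.

(** By Riesz each coordinate is the inner product with a fixed vector, hence Lipschitz, so the
    coordinates of a Cauchy filter converge in [R]. *)
Lemma finite_dim_cauchy_cvg (F : set_system X) :
  ProperFilter F -> cauchy F -> cvg F.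
Proof.
move=> FF cF.
have coord_cvg (i : 'I_(\dim {:X})) :
    exists l : R, coord (vbasis {:X}) i x @[x --> F] --> l.
  apply/cvg_ex/cauchy_cvgP/cauchyP => eps eps0.
  have [r rE] := coord_riesz norm_ip i.
  have r0 : 0 < `|r| + 1 by rewrite ltr_wpDl.
  have /cauchyP/(_ _ (divr_gt0 eps0 r0))[x Fx] := cF.
  exists (coord (vbasis {:X}) i x); apply: (@filterS _ F _ _ _ _ Fx) => y.
  rewrite -!ball_normE/= => xy.
  rewrite !rE -ipNr -ipDr (le_lt_trans (norm_ip_le norm_ip _ _))//.
  rewrite (@le_lt_trans _ _ ((`|r| + 1) * `|x - y|))//.
    by rewrite ler_wpM2r// lerDl.
  by rewrite mulrC -ltr_pdivlMr.
have /choice[l lP] := coord_cvg.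
have key : \sum_(j < \dim {:X}) coord (vbasis {:X}) j x *: (vbasis {:X})`_j
    @[x --> F] --> \sum_j l j *: (vbasis {:X})`_j.
  apply: cvg_big => [|i _]; first exact: add_continuous.
  by apply: cvgZr_tmp; exact: lP.
apply/cvg_ex; exists (\sum_j l j *: (vbasis {:X})`_j).
by move: key; under eq_cvg do rewrite -coordE.
Qed.

(** Shows that the supremum defining [opnorm] is taken over a bounded set. *)
Lemma lfun_bounded (T : 'End(X)) :
  exists2 M : R, 0 <= M & forall x, `|T x| <= M * `|x|.
Proof.
have /choice[r rE] := coord_riesz norm_ip.
exists (\sum_(j < \dim {:X}) `|r j| * `|T (vbasis {:X})`_j|).
  by apply: sumr_ge0 => j _; rewrite mulr_ge0.
move=> x; rewrite {1}(coordE x) linear_sum (le_trans (ler_norm_sum _ _ _))//.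
rewrite mulr_suml; apply: ler_sum => j _.
by rewrite linearZ/= normrZ rE mulrAC ler_wpM2r// norm_ip_le.
Qed.

Lemma opnorm_ub (T : 'End(X)) (x : X) : `|T x| <= opnorm T * `|x|.
Proof.
have [->|x0] := eqVneq x 0; first by rewrite linear0 !normr0 mulr0.
have nx : 0 < `|x| by rewrite normr_gt0.
rewrite -ler_pdivrMr//; have [M M0 TM] := lfun_bounded T.
apply: ub_le_sup.
  by exists M => _ [y /= y1 <-]; rewrite (le_trans (TM y))// y1 mulr1.
exists (`|x|^-1 *: x) => /=.
  by rewrite normrZ normfV normr_id mulVf// gt_eqF.
by rewrite linearZ/= normrZ normfV normr_id mulrC.
Qed.

Lemma opnorm_ge0 (T : 'End(X)) : 0 <= opnorm T.
Proof.
have [[x x0]|X0] := pselect (exists x : X, x != 0).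
  have nx : 0 < `|x| by rewrite normr_gt0.
  by rewrite -(pmulr_lge0 _ nx) (le_trans _ (opnorm_ub T x)).
(* In the zero space there is no unit vector, and [sup set0 = 0]. *)
rewrite /opnorm (_ : [set `|T x| | x in _] = set0) ?sup0//.
apply/seteqP; split => // _ [x /= x1 _]; apply: X0; exists x.
by rewrite -normr_eq0 x1 oner_eq0.
Qed.

Lemma contraction_fixpoint (f : X -> X) (q : R) : 0 <= q < 1 ->
  (forall x y, `|f x - f y| <= q * `|x - y|) -> exists x, f x = x.
Proof.
move=> /andP[q0 q1] fq.
(* Completeness is added to [X] as a structure, so that Banach's theorem applies on the whole
   space. *)
pose XcM := Uniform_isComplete.Build X finite_dim_cauchy_cvg.
pose Xc : completeNormedModType R := HB.pack (X : Type) X XcM.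
pose g : Xc -> Xc := f.
have gfun : set_fun [set: Xc] [set: Xc] g by [].
pose gM := isFun.Build _ _ _ _ g gfun.
pose gF : {fun [set: Xc] >-> [set: Xc]} := HB.pack g gM.
have ctr : is_contraction gF.
  by exists (NngNum q0); split => //= -[x y] _; exact: fq.
have [p _ pE] := banach_fixed_point ctr closedT (ex_intro _ (0 : Xc) I).
by exists p; rewrite [RHS]pE.
Qed.

End FiniteDimension.

(** [u] is the midpoint of [2 *: u - v] and [v]. This turns reflection bounds into
    nonexpansiveness. *)
Lemma norm_le_reflection (R : realType) (X : normedModType R) (u v : X) :
  `|2 *: u - v| <= `|v| -> `|u| <= `|v|.
Proof.
move=> h; have -> : u = 2^-1 *: (2 *: u - v + v).
  by rewrite subrK scalerA mulVf ?scale1r.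
rewrite normrZ gtr0_norm//.
by have := ler_normD (2 *: u - v) v; lra.
Qed.

(** * Metric projection: existence, obtuse angles, reflection, homogeneity *)

Section Projection.
Context (R : realType) (X : normedVectType R) (ip : {dot X for idfun}).
Hypothesis norm_ip : forall x : X, `|x| = Num.sqrt (ip x x).
Context (K : set X).
Hypothesis K_nonempty : K !=set0.
Hypothesis K_closed : closed K.
Hypothesis K_convex : convex_set K.

Let ipE := (ipDl, ipDr, ipZl, ipZr, ipNl, ipNr).

Lemma convex_setP (t : R) (x y : X) :
  0 <= t <= 1 -> K x -> K y -> K (t *: x + (1 - t) *: y).
Proof.
move=> /andP[t0 t1] Kx Ky.
by have := K_convex (Itv01 t0 t1) (mem_set Kx) (mem_set Ky); rewrite inE.
Qed.

(** Parallelogram law for [y - x] and [z - x]. It forces almost nearest points of [K] together,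
    since their midpoint is again in [K]. *)
Lemma sqr_norm_midpoint (x y z : X) :
  `|y - z| ^+ 2 = 2 * `|y - x| ^+ 2 + 2 * `|z - x| ^+ 2
                  - 4 * `|2^-1 *: y + (1 - 2^-1) *: z - x| ^+ 2.
Proof.
rewrite -!(ip_norm norm_ip) !ipE (ipC ip z y) (ipC ip x y) (ipC ip x z).
by field.
Qed.

Lemma argmin_dist_nonempty (x : X) : exists p, argmin K (fun y => `|y - x|) p.
Proof.
pose S := [set `|y - x| ^+ 2 | y in K]; set d := inf S.
have lbS : has_lbound S by exists 0 => _ [y _ <-]; exact: sqr_ge0.
have dle y : K y -> d <= `|y - x| ^+ 2 by move=> Ky; apply: ge_inf => //; exists y.
have S0 : S !=set0 by have [y Ky] := K_nonempty; exists (`|y - x| ^+ 2), y.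
have /choice[u uP] (n : nat) : exists y, K y /\ `|y - x| ^+ 2 < d + harmonic n.
  have [_ [y Ky <-] yd] := @inf_adherent _ S _ (harmonic_gt0 n) (conj S0 lbS).
  by exists y.
have ucauchy : cauchy (u @ \oo).
  (* The tolerance [e ^+ 2 / 4] fits the midpoint identity: twice the sum of the two harmonic errors
     stays below [e ^+ 2]. *)
  apply/cauchyP => e e0; have e4 : 0 < e ^+ 2 / 4 by rewrite divr_gt0 ?exprn_gt0.
  have /cvgr0Pnorm_lt/(_ _ e4)[N _ Nh] := @cvg_harmonic R.
  exists (u N); exists N => // n /= Nn.
  rewrite -ball_normE/= -(@ltr_pXn2r _ 2)// ?nnegrE ?(ltW e0)// (sqr_norm_midpoint x).
  have half01 : 0 <= (2^-1 : R) <= 1 by apply/andP; split; lra.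
  have := dle _ (convex_setP half01 (uP N).1 (uP n).1).
  have := (uP N).2; have := (uP n).2.
  have := Nh N (leqnn N); have := Nh n Nn.
  rewrite !ger0_norm ?harmonic_ge0//.
  lra.
have [p up] : exists p : X, u n @[n --> \oo] --> p.
  by apply/cvg_ex; exact: (finite_dim_cauchy_cvg norm_ip).
exists p; split.
  by apply: (closed_cvg _ K_closed _ _ up); apply: nearW => n; exact: (uP n).1.
move=> y Ky; rewrite -(@ler_pXn2r _ 2)// ?nnegrE//.
apply: le_trans (dle y Ky).
have pn : `|u n - x| ^+ 2 @[n --> \oo] --> `|p - x| ^+ 2.
  have un : `|u n - x| @[n --> \oo] --> `|p - x|.
    by apply: cvg_norm; apply: cvgB => //; exact: cvg_cst.
  by rewrite expr2; under eq_cvg do rewrite expr2; exact: cvgM.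
have dn : d + harmonic n @[n --> \oo] --> d + 0.
  by apply: cvgD; [exact: cvg_cst|exact: cvg_harmonic].
rewrite addr0 in dn; apply: (ler_cvg_to pn dn); apply: nearW => n.
exact/ltW/(uP n).2.
Qed.

Lemma argmin_obtuse (x p y : X) :
  argmin K (fun z => `|z - x|) p -> K y -> ip (x - p) (y - p) <= 0.
Proof.
move=> [Kp pmin] Ky; rewrite leNgt; apply/negP; set c := ip _ _ => c0.
set s := `|y - p| ^+ 2; have s0 : 0 <= s by exact: sqr_ge0.
(* Moving from [p] towards [y] by the fraction [t] cannot shorten the distance to [x]; dividing the
   expanded inequality by [t] leaves this bound. *)
have key t : 0 <= t <= 1 -> 0 < t -> 2 * c <= t * s.
  move=> t01 t0; have /= := pmin _ (convex_setP t01 Ky Kp).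
  rewrite -(@ler_pXn2r _ 2 _ `|p - x|)// ?nnegrE// -!(ip_norm norm_ip) => h.
  rewrite -(ler_pM2l t0) /c /s -(ip_norm norm_ip); move: h; rewrite !ipE.
  rewrite (ipC ip p y) (ipC ip x y) (ipC ip x p) => h.
  lra.
have s1 : 0 < s + c by rewrite ltr_wpDl.
(* This [t] is small enough to contradict [key], and lies in [[0, 1]] even when [s = 0]. *)
have t0 : 0 < c / (s + c) by rewrite divr_gt0.
have t01 : 0 <= c / (s + c) <= 1.
  by rewrite ltW//= ler_pdivrMr// mul1r lerDr.
have := key _ t01 t0; rewrite mulrAC ler_pdivlMr//.
nra.
Qed.

Lemma metric_projP (x : X) : argmin K (fun y => `|y - x|) (metric_proj K x).
Proof. exact: getPex (argmin_dist_nonempty x). Qed.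

(** The two obtuse-angle inequalities add up to [|q - p|^2 <= 0], so the choice made by [get] is
    immaterial. *)
Lemma metric_proj_eq (x p : X) :
  argmin K (fun y => `|y - x|) p -> metric_proj K x = p.
Proof.
move=> pP; have qP := metric_projP x; set q := metric_proj K x in qP *.
apply/eqP; rewrite -subr_eq0 -normr_eq0 -sqrf_eq0 eq_le sqr_ge0 andbT.
have := argmin_obtuse pP qP.1; have := argmin_obtuse qP pP.1.
rewrite -(ip_norm norm_ip) !ipE (ipC ip q p).
lra.
Qed.

(** With [p], [q] the projections of [x], [y], the obtuse-angle inequalities add up to firm
    nonexpansiveness, [|p - q|^2 <= <p - q, x - y>]. Expanding the squared norms shows this to be
    the same claim. *)
Lemma metric_proj_reflection (x y : X) :
  `|2 *: (metric_proj K x - metric_proj K y) - (x - y)| <= `|x - y|.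
Proof.
rewrite -(@ler_pXn2r _ 2)// ?nnegrE// -!(ip_norm norm_ip).
have := argmin_obtuse (metric_projP y) (metric_projP x).1.
have := argmin_obtuse (metric_projP x) (metric_projP y).1.
set p := metric_proj K x; set q := metric_proj K y.
rewrite !ipE (ipC ip q p) (ipC ip y x) (ipC ip p x) (ipC ip p y).
rewrite (ipC ip q y) (ipC ip q x).
lra.
Qed.

Lemma metric_proj_nonexpansive (x y : X) :
  `|metric_proj K x - metric_proj K y| <= `|x - y|.
Proof. exact/norm_le_reflection/metric_proj_reflection. Qed.

(** Scaling by [t] maps [K] onto itself and multiplies distances by [t], so it carries minimizers to
    minimizers. *)
Lemma metric_proj_homogeneous (t : R) (x : X) : cone K -> 0 < t ->
  metric_proj K (t *: x) = t *: metric_proj K x.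
Proof.
move=> K_cone t0; apply: metric_proj_eq; have [Kp pmin] := metric_projP x.
split; first exact: K_cone.
move=> y Ky; rewrite -scalerBr normrZ gtr0_norm//.
have -> : y - t *: x = t *: (t^-1 *: y - x).
  by rewrite scalerBr scalerA divff ?scale1r// gt_eqF.
rewrite normrZ gtr0_norm// ler_pM2l//; apply: pmin.
by apply: K_cone; rewrite ?invr_gt0.
Qed.

End Projection.

(** * Reflection bound and Euler's identity for Clarke Jacobians *)

Section ClarkeJacobian.
Context (R : realType) (X : normedVectType R) (ip : {dot X for idfun}).
Hypothesis norm_ip : forall x : X, `|x| = Num.sqrt (ip x x).
Context (F : X -> X).

(** The hypothesis at [h *: v + x] and [x], divided by [|h|], bounds the difference quotients, and
    the bound survives the limit. *)
Lemma differential_reflection (x v : X) :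
  (forall y z, `|2 *: (F y - F z) - (y - z)| <= `|y - z|) ->
  differentiable F x -> `|2 *: 'd F x v - v| <= `|v|.
Proof.
move=> Frefl dF; rewrite -deriveE//.
have cvg_q : h^-1 *: (F (h *: v + x) - F x) @[h --> 0^'] --> 'D_v F x.
  exact: diff_derivable.
have cvg_n : `|2 *: (h^-1 *: (F (h *: v + x) - F x)) - v| @[h --> 0^'] -->
    `|2 *: 'D_v F x - v|.
  by apply: cvg_norm; apply: cvgB; [exact: cvgZl_tmp|exact: cvg_cst].
apply: (ler_cvg_to cvg_n (cvg_cst _)); near=> h.
have h0 : h != 0 by near: h; exact: nbhs_dnbhs_neq.
have -> : 2 *: (h^-1 *: (F (h *: v + x) - F x)) - v =
    h^-1 *: (2 *: (F (h *: v + x) - F x) - (h *: v + x - x)).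
  by rewrite addrK [RHS]scalerBr !scalerA mulVf// scale1r mulrC.
rewrite normrZ normfV ler_pdivrMl ?normr_gt0// -normrZ.
by rewrite (le_trans (Frefl _ _))// addrK.
Unshelve. all: by end_near. Qed.

(** Once [h + 1 > 0], homogeneity gives [F (h *: x + x) - F x = h *: F x], so the difference
    quotient in direction [x] is constant near [0]. *)
Lemma euler_homogeneous (x : X) :
  (forall (t : R) y, 0 < t -> F (t *: y) = t *: F y) ->
  differentiable F x -> 'd F x x = F x.
Proof.
move=> Fhom dF; rewrite -deriveE//; apply: cvg_lim => //.
apply: cvg_near_cst; near=> h => /=.
have h0 : h != 0 by near: h; exact: nbhs_dnbhs_neq.
have h1 : 0 < h + 1.
  have : `|h| < 1 by near: h; apply: dnbhs0_lt.
  by rewrite ltr_norml => /andP[]; lra.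
rewrite -{2}(scale1r x) -scalerDl Fhom// -{2}(scale1r (F x)) -scalerBl addrK.
by rewrite scalerA mulVf// scale1r.
Unshelve. all: by end_near. Qed.

(** Joint continuity of evaluation, so that converging Jacobians can be applied to the moving points
    [x_ k]. *)
Lemma cvg_lfun_app (A : nat -> 'End(X)) (L : 'End(X)) (y_ : nat -> X) (y : X) :
  opnorm (A k - L) @[k --> \oo] --> (0 : R) -> y_ @ \oo --> y ->
  A k (y_ k) @[k --> \oo] --> L y.
Proof.
move=> AL yy; apply/subr_cvg0/norm_cvg0P.
have yy0 : `|y_ k - y| @[k --> \oo] --> (0 : R).
  by apply/norm_cvg0P; apply/subr_cvg0.
have ub : opnorm (A k - L) * `|y_ k| + opnorm L * `|y_ k - y| @[k --> \oo]
    --> (0 : R).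
  rewrite -[X in _ --> X](_ : 0 * `|y| + opnorm L * 0 = 0); last first.
    by rewrite mul0r mulr0 addr0.
  apply: cvgD; first by apply: cvgM => //; exact: cvg_norm.
  by apply: cvgM => //; exact: cvg_cst.

apply: squeeze_cvgr (cvg_cst (0 : R)) ub; apply: nearW => k.
rewrite normr_ge0/=.
have -> : A k (y_ k) - L y = (A k - L) (y_ k) + L (y_ k - y).
  by rewrite add_lfunE opp_lfunE linearB/= addrA subrK.
by rewrite (le_trans (ler_normD _ _))// lerD// (opnorm_ub norm_ip).
Qed.

Lemma clarke_reflection (x v : X) (V : 'End(X)) :
  (forall y z, `|2 *: (F y - F z) - (y - z)| <= `|y - z|) ->
  clarke_jacobian F x V -> `|2 *: V v - v| <= `|v|.
Proof.
move=> Frefl [n [t [s [t0 t1 slim ->]]]].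
have s_refl i : `|2 *: s i v - v| <= `|v|.
  have [x_ [dF _ sL]] := slim i.
  have sv := cvg_lfun_app sL (cvg_cst v).
  have cvg_n : `|2 *: linfun ('d F (x_ k)) v - v| @[k --> \oo] -->
      `|2 *: s i v - v|.
    by apply: cvg_norm; apply: cvgB; [apply: cvgZl_tmp; exact: sv|exact: cvg_cst].
  apply: (ler_cvg_to cvg_n (cvg_cst _)); apply: nearW => k.
  by rewrite lfunE; exact: differential_reflection.
(* Since the weights sum to [1], [v] can be moved inside the convex combination. *)
have -> : 2 *: (\sum_(i < n) t i *: s i) v - v =
    \sum_(i < n) t i *: (2 *: s i v - v).
  rewrite sum_lfunE scaler_sumr -[X in _ - X = _]scale1r -[X in _ - X *: _]t1 scaler_suml -sumrB.
  by apply: eq_bigr => i _; rewrite scale_lfunE scalerBr !scalerA mulrC.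
rewrite (le_trans (ler_norm_sum _ _ _))// -[leRHS]mul1r -[X in _ <= X * _]t1 mulr_suml.
by apply: ler_sum => i _; rewrite normrZ ger0_norm ?ler_wpM2l.
Qed.

(** Euler's identity holds at the differentiability points [x_ k] and passes to the limit, as [F] is
    continuous; [x] itself may be a kink. *)
Lemma clarke_homogeneous (x : X) (V : 'End(X)) :
  (forall y z, `|F y - F z| <= `|y - z|) ->
  (forall (t : R) y, 0 < t -> F (t *: y) = t *: F y) ->
  clarke_jacobian F x V -> V x = F x.
Proof.
move=> Fnexp Fhom [n [t [s [_ t1 slim ->]]]].
rewrite sum_lfunE -[RHS]scale1r -t1 scaler_suml; apply: eq_bigr => i _.
rewrite scale_lfunE; congr (_ *: _); have [x_ [dF xx sL]] := slim i.
have Fx : F (x_ k) @[k --> \oo] --> F x.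
  apply/subr_cvg0/norm_cvg0P.
  have xx0 : `|x_ k - x| @[k --> \oo] --> (0 : R).
    by apply/norm_cvg0P; apply/subr_cvg0.

  apply: squeeze_cvgr (cvg_cst (0 : R)) xx0; apply: nearW => k.
  by rewrite normr_ge0/=.
apply: (cvg_unique _ _ Fx); first exact: norm_hausdorff.
have := cvg_lfun_app sL xx; under eq_cvg do rewrite lfunE/= euler_homogeneous//.
exact.
Qed.

End ClarkeJacobian.

(** * Solvability of the equation and of the Newton systems, and the error of one step *)

Section NewtonStep.
Context (R : realType) (X : normedVectType R) (ip : {dot X for idfun}).
Hypothesis norm_ip : forall x : X, `|x| = Num.sqrt (ip x x).
Context (T : 'End(X)).
Hypothesis T_inv : bijective T.

Let ker_T : lker T == 0%VS.
Proof. exact/lker0P/bij_inj. Qed.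

Lemma norm_le_opnorm_inv (x : X) : `|x| <= opnorm T^-1%VF * `|T x|.
Proof. by rewrite -{1}(lker0_lfunK ker_T x) (opnorm_ub norm_ip). Qed.

Lemma fixpoint_equation_solvable (F : X -> X) (b : X) : opnorm T^-1%VF < 1 ->
  (forall x y, `|F x - F y| <= `|x - y|) -> exists x, F x + T x = b.
Proof.
move=> T_lt1 Fnexp.
have [x fx] : exists x, (T^-1)%VF (b - F x) = x.
  apply: (contraction_fixpoint norm_ip (q := opnorm T^-1%VF)).
    by rewrite (opnorm_ge0 norm_ip).
  move=> x y; rewrite -linearB/= opprB addrC addrA subrK.
  rewrite (le_trans (opnorm_ub norm_ip _ _))// ler_wpM2l ?(opnorm_ge0 norm_ip)//.
  by rewrite distrC Fnexp.
by exists x; rewrite -{2}fx lker0_lfunVK// addrC subrK.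
Qed.

(** Subtracting the equations gives [T (x - y) = F y - F x], hence [|x - y| <= c |x - y|] with
    [c = opnorm T^-1 < 1]. *)
Lemma fixpoint_equation_unique (F : X -> X) (x y : X) : opnorm T^-1%VF < 1 ->
  (forall x y, `|F x - F y| <= `|x - y|) -> F x + T x = F y + T y -> x = y.
Proof.
move=> T_lt1 Fnexp xy; apply/eqP; rewrite -subr_eq0 -normr_le0.
have := norm_le_opnorm_inv (x - y).
have -> : T (x - y) = F y - F x.
  by rewrite linearB/=; apply/eqP; rewrite subr_eq addrAC -xy addrC addKr.
have := Fnexp y x; rewrite [`|y - x|]distrC.
have := opnorm_ge0 norm_ip T^-1%VF.
have := normr_ge0 (x - y); have := normr_ge0 (F y - F x).
nra.
Qed.

(** A kernel vector [w] has [T w = - V w], so [|w| <= opnorm T^-1 * |w|], which forces [w = 0]. *)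
Lemma newton_system_ker (V : 'End(X)) : opnorm T^-1%VF < 1 ->
  (forall v, `|V v| <= `|v|) -> lker (V + T) == 0%VS.
Proof.
move=> T_lt1 Vnexp; apply/lker0P => x y xy; apply/eqP.
rewrite -subr_eq0 -normr_le0.
have := norm_le_opnorm_inv (x - y).
have -> : T (x - y) = - V (x - y).
  apply/eqP; rewrite -addr_eq0 addrC -add_lfunE linearB/= xy subrr.
  by [].
rewrite normrN; have := Vnexp (x - y); have := opnorm_ge0 norm_ip T^-1%VF.
have := normr_ge0 (x - y); have := normr_ge0 (V (x - y)).
nra.
Qed.

Lemma newton_step_estimate (F : X -> X) (V : 'End(X)) (b xbar x x' : X) :
  opnorm T^-1%VF < 1 ->
  (forall y z, `|2 *: (F y - F z) - (y - z)| <= `|y - z|) ->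
  (forall v, `|2 *: V v - v| <= `|v|) -> (forall v, `|V v| <= `|v|) ->
  V x = F x -> F xbar + T xbar = b -> (V + T) x' = b ->
  `|x' - xbar| <= opnorm T^-1%VF / (1 - opnorm T^-1%VF) * `|x - xbar|.
Proof.
move=> T_lt1 Frefl Vrefl Vnexp Vx xbarP x'P.
pose e := F xbar - F x - V (xbar - x).
have eE : T (x' - xbar) = e - V (x' - xbar).
  have Tx' : T x' = b - V x' by rewrite -x'P add_lfunE addrC addKr.
  have Txbar : T xbar = b - F xbar by rewrite -xbarP addrC addKr.
  (* Euler's identity [V x = F x] removes [x] from [e]. *)
  have -> : e = F xbar - V xbar.
    by rewrite /e linearB/= Vx; set d := F x; rewrite opprB addrA subrK.
  rewrite (linearB T) (linearB V)/= Tx' Txbar [in RHS]opprB [RHS]addrA subrK.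
  by rewrite opprB [LHS]addrC [LHS]addrA subrK.
have e_le : `|e| <= `|x - xbar|.
  (* Bounding the two terms of [e] separately would give [2 |x - xbar|]; the reflections save the
     factor [2]. *)
  have -> : e = 2^-1 *: ((2 *: (F xbar - F x) - (xbar - x))
                        - (2 *: V (xbar - x) - (xbar - x))).
    rewrite /e; move: (xbar - x) => d.
    by rewrite [in RHS]opprB [in RHS]addrA subrK -scalerBr scalerA mulVf ?scale1r.
  rewrite normrZ gtr0_norm// [`|x - xbar|]distrC.
  have := ler_normB (2 *: (F xbar - F x) - (xbar - x))
                    (2 *: V (xbar - x) - (xbar - x)).
  have := Frefl xbar x; have := Vrefl (xbar - x).
  lra.
have c1 : 0 < 1 - opnorm T^-1%VF by rewrite subr_gt0.
rewrite mulrAC ler_pdivlMr//.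
have := norm_le_opnorm_inv (x' - xbar); rewrite eE.
have := ler_normB e (V (x' - xbar)); have := Vnexp (x' - xbar).
have := opnorm_ge0 norm_ip T^-1%VF.
move: e_le; set c := opnorm _; set u := `|x' - xbar|; set w := `|x - xbar|.
move=> e_le c0 Vu eV uc.
(* From [u <= c (w + u)] the term [c u] is absorbed on the left, which produces the factor
   [1 / (1 - c)]. *)
have : c * `|e - V (x' - xbar)| <= c * (w + u).
  by rewrite ler_wpM2l// (le_trans eV)// lerD.
lra.
Qed.

End NewtonStep.

(** * Geometric convergence and the three claims together *)

Lemma geometric_bound_cvg (R : realType) (X : normedModType R) (x : nat -> X)
    (l : X) (r : R) : 0 <= r < 1 ->
  (forall k, `|x k.+1 - l| <= r * `|x k - l|) -> x @ \oo --> l.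
Proof.
move=> /andP[r0 r1] xr.
have bound k : `|x k - l| <= geometric `|x 0%N - l| r k.
  elim: k => [|k ih]; first by rewrite /geometric/= expr0 mulr1.
  rewrite (le_trans (xr k))// /geometric/= exprS mulrCA.
  by rewrite ler_wpM2l.
apply/subr_cvg0/norm_cvg0P.
have geo0 : geometric `|x 0%N - l| r n @[n --> \oo] --> (0 : R).
  by apply: cvg_geometric; rewrite ger0_norm.
apply: squeeze_cvgr (cvg_cst (0 : R)) geo0; apply: nearW => k.
by rewrite normr_ge0/=.
Qed.

Theorem theorem3p2 (R : realType) (X : normedVectType R)
    (ip : {dot X for idfun}) (norm_ip : forall x : X, `|x| = Num.sqrt (ip x x))
    (K : set X) (K_nonempty : K !=set0) (K_closed : closed K)
    (K_convex : convex_set K) (K_cone : cone K)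
    (b : X) (T : 'End(X)) (T_inv : bijective T)
    (T_lt1 : opnorm (T^-1)%VF < 1) :
  exists xbar : X,
    [/\ unique (fun x => metric_proj K x + T x = b) xbar,
        forall x0 : X, newton_well_defined (metric_proj K) T b x0
      & opnorm (T^-1)%VF < 1 / 2 ->
        forall (x0 : X) (x : nat -> X) (V : nat -> 'End(X)),
          newton_sequence (metric_proj K) T b x0 x V ->
          Qlinear_cvg x xbar /\
          forall k : nat,
            `|x k.+1 - xbar| <=
              opnorm (T^-1)%VF / (1 - opnorm (T^-1)%VF) * `|x k - xbar| ].
Proof.
set P := metric_proj K; set c := opnorm _ in T_lt1 *.
have Prefl := metric_proj_reflection norm_ip K_nonempty K_closed K_convex.
have Pnexp := metric_proj_nonexpansive norm_ip K_nonempty K_closed K_convex.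
have Phom (t : R) (y : X) : 0 < t -> P (t *: y) = t *: P y.
  exact: (metric_proj_homogeneous norm_ip).
have Vrefl y V v : clarke_jacobian P y V -> `|2 *: V v - v| <= `|v|.
  exact: (clarke_reflection norm_ip).
have Vnexp y V v : clarke_jacobian P y V -> `|V v| <= `|v|.
  by move=> yV; exact: norm_le_reflection (Vrefl _ _ v yV).
have VT_ker y V : clarke_jacobian P y V -> lker (V + T) == 0%VS.
  by move=> yV; apply: (newton_system_ker norm_ip) => // v; exact: Vnexp yV.
have [xbar xbarP] := fixpoint_equation_solvable norm_ip T_inv b T_lt1 Pnexp.
exists xbar; split.
- split=> // y yP; apply: (fixpoint_equation_unique norm_ip T_inv T_lt1 Pnexp).
  by rewrite xbarP.
- move=> x0; split=> [n x V [_ /(_ n (leqnn n)) VP _]|V VP].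
    (* In finite dimension a trivial kernel makes the linear inverse two-sided. *)
    have ker0 := VT_ker _ _ VP.
    by exists ((V n + T)^-1)%VF; [exact: lker0_lfunK|exact: lker0_lfunVK].
  (* The rule [V] is fixed, so inverting each system defines the sequence recursively; induction
     then shows that it is the only one. *)
  pose x := fix x k := if k is k'.+1 then ((V k' (x k') + T)^-1)%VF b else x0.
  exists x; split=> [|y [y0 _ yS]].
    by split=> // k; rewrite lker0_lfunVK// (VT_ker (x k)).
  apply/funext; elim=> [|k ih]; first by rewrite y0.
  have ker0 := VT_ker _ _ (VP k (y k)).
  by rewrite /= ih -(yS k) lker0_lfunK.
- move=> c_lt x0 x V [_ VP xS].
  have step k : `|x k.+1 - xbar| <= c / (1 - c) * `|x k - xbar|.
    apply: (newton_step_estimate norm_ip T_inv T_lt1 Prefl _ _ _ xbarP (xS k)).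
    + by move=> v; exact: Vrefl (VP k).
    + by move=> v; exact: Vnexp (VP k).
    + exact: (clarke_homogeneous norm_ip).
  have c0 : 0 <= c := opnorm_ge0 norm_ip _.
  have c1 : 0 < 1 - c by rewrite subr_gt0.
  (* Here [c / (1 - c) < 1] amounts to [c < 1 / 2]. *)
  have r01 : 0 <= c / (1 - c) < 1.
    by rewrite divr_ge0//= ?(ltW c1)// ltr_pdivrMr//; lra.
  by split=> //; split; [exact: geometric_bound_cvg step|exists (c / (1 - c))].
Qed.
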